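(* Let $\mathcal{C}$ be a crystal framework in $\mathbb{R}^3$ with motif $(F_v,F_e)$ and matrix function $\Phi_{\mathcal{C}}(z)$, let $r=(r_1,r_2,r_3)$ be positive integers, and let $\Phi^r$ be the restriction of $\Phi_{\mathcal{C}}$ to the finite torus $\mathbb{T}^3_r$. Then (i) $U_a$ and $U_b$ are unitary and the rigidity transformation $R^{(r)}:\mathcal{K}^r_a\to\mathcal{K}^r_b$ for $r$-periodic displacements satisfies $R^{(r)}=U_b^*M_{\Phi^r}U_a$; (ii) the number of $r$-periodic floppy modes is \[\dim\ker R^{(r)}=\dim\ker M_{\Phi^r}=\sum_{k\in r}\dim\ker\Phi_{\mathcal{C}}(\omega^k),\] where $\omega=(e^{2\pi i/r_1},e^{2\pi i/r_2},e^{2\pi i/r_3})$, $\omega^k=(\omega_1^{k_1},\omega_2^{k_2},\omega_3^{k_3})$, and the sum runs over the $r_1r_2r_3$ indices $k=(k_1,k_2,k_3)$ with $0\le k_i\le r_i-1$.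
   Context: A crystal framework $\mathcal{C}$ in $\mathbb{R}^3$ with full rank translation group $\{T_k:k\in\mathbb{Z}^3\}$ ($T_kx=x+k_1a+k_2b+k_3c$, $a,b,c$ not coplanar) and finite motif $(F_v,F_e)$ is a connected bar-joint framework with vertices $p_{\kappa,k}=T_kp_{\kappa,0}$, $F_v=\{p_{\kappa,0}:1\le\kappa\le n\}$, $F_e$ a finite set of edges each with a vertex in $F_v$, the edge set being the disjoint union of the $T_k(F_e)$. Each $e\in F_e$ is nonreflexive, $e=[p_{\kappa,\delta(e,\kappa)},p_{\tau,\delta(e,\tau)}]$ with $\kappa\neq\tau$, or reflexive, $e=[p_{\kappa,0},p_{\kappa,\delta(e)}]$. For $z\in\mathbb{T}^3$, $\bar z^\delta=\overline{z_1^{\delta_1}z_2^{\delta_2}z_3^{\delta_3}}$; $p_{\kappa,\sigma,k}$ is the $\sigma$-th coordinate of $p_{\kappa,k}$. $\Phi_{\mathcal{C}}(z)$ is the $|F_e|\times 3|F_v|$ matrix with rows $e\in F_e$, columns $(\kappa,\sigma)$, $\sigma\in\{1,2,3\}$: for nonreflexive $e$, entries $(p_{\kappa,\sigma,\delta(e,\kappa)}-p_{\tau,\sigma,\delta(e,\tau)})\bar z^{\delta(e,\kappa)}$ in column $(\kappa,\sigma)$ and $-(p_{\kappa,\sigma,\delta(e,\kappa)}-p_{\tau,\sigma,\delta(e,\tau)})\bar z^{\delta(e,\tau)}$ in column $(\tau,\sigma)$; for reflexive $e$, entry $(p_{\kappa,\sigma,0}-p_{\kappa,\sigma,\delta(e)})(1-\bar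 z^{\delta(e)})$ in column $(\kappa,\sigma)$; zeros elsewhere. The rigidity matrix $R(\mathcal{C})$ maps complex displacement vectors $u=(u_{\kappa,k})$, $u_{\kappa,k}\in\mathbb{C}^3$, to bond sequences indexed by $(e,k)$ ($e\in F_e$, $k\in\mathbb{Z}^3$, the edge $T_ke=[p_a,p_b]$) by $(R(\mathcal{C})u)_{(e,k)}=\sum_\sigma(p_a-p_b)_\sigma((u_a)_\sigma-(u_b)_\sigma)$. $\mathcal{K}^r_a$ (resp. $\mathcal{K}^r_b$) is the space of complex $r$-periodic displacement vectors (resp. bond sequences), periodic meaning invariant under index shifts by $m$ with $r_i\mid m_i$; $R^{(r)}$ is the restriction of $R(\mathcal{C})$. Write $k\in r$ for $k\in\mathbb{Z}^3$ with $0\le k_i\le r_i-1$. $\mathcal{K}^r_a$ has basis $\dot\xi_{\kappa,\sigma,k}$ ($k\in r$), the $r$-periodic vector with $(\kappa',\sigma',k')$ coordinate $\delta_{\kappa\kappa'}\delta_{\sigma\sigma'}$ if $k'\equiv k$ modulo $r$ componentwise and $0$ otherwise; $\mathcal{K}^r_b$ has basis $\dot\eta_{e,k}$ defined analogously; these bases are declared orthonormal. $\mathbb{T}^3_r=\{\omega^k:k\in r\}$ and $L^2(\mathbb{T}^3_r)$ carries normalised counting measure; $\{\xi_{\kappa,\sigma}\}$ and $\{\eta_e\}$ are the standard bases of $\mathbb{C}^{3|F_v|}$ and $\mathbb{C}^{|F_e|}$. $U_a:\mathcal{K}^r_a\to L^2(\mathbb{T}^3_r)\otimes\mathbb{C}^{3|F_v|}$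 is the linear map with $U_a\dot\xi_{\kappa,\sigma,k}=(w\mapsto w^k\xi_{\kappa,\sigma})$, and $U_b:\mathcal{K}^r_b\to L^2(\mathbb{T}^3_r)\otimes\mathbb{C}^{|F_e|}$ has $U_b\dot\eta_{e,k}=(w\mapsto w^k\eta_e)$. $M_{\Phi^r}$ is the multiplication map $(M_{\Phi^r}F)(w)=\Phi^r(w)F(w)$. *)

(* Defs.v *)
From HB Require Import structures.
From mathcomp Require Import all_boot all_order all_algebra finmap.
From mathcomp Require Import all_classical all_reals all_analysis.
From mathcomp Require Import complex ring.

Set Implicit Arguments.
Unset Strict Implicit.
Unset Printing Implicit Defensive.

Import Order.TTheory GRing.Theory Num.Theory.
Local Open Scope ring_scope.
Local Open Scope complex_scope.

Notation Z3 := 'rV[int]_3.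

(* A vertex is its label [(kappa, k)], standing for the point p_{kappa,k}. *)
Definition vertex (n : nat) : choiceType := ('I_n * Z3)%type.

Definition shiftv n (k : Z3) (v : vertex n) : vertex n := (v.1, v.2 + k).

(* An edge is stored with an ordering of its ends; [same_edge] compares the
   underlying unordered pairs. *)
Definition edge (n : nat) : choiceType := (vertex n * vertex n)%type.

Definition shifte n (k : Z3) (e : edge n) : edge n :=
  (shiftv k e.1, shiftv k e.2).

Definition same_edge n (e e' : edge n) : Prop :=
  e = e' \/ e = (e'.2, e'.1).

Definition reflexive_edge n (e : edge n) : bool := e.1.1 == e.2.1.

Definition translate (R : realType) (a b c : 'rV[R]_3) (k : Z3) (x : 'rV[R]_3) :
    'rV[R]_3 :=
  x + (k 0 0)%:~R *: a + (k 0 1)%:~R *: b + (k 0 2%:R)%:~R *: c.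

Definition adjacent n (Fe : {fset edge n}) (v w : vertex n) : Prop :=
  exists2 e : edge n, e \in Fe & exists k : Z3, same_edge (v, w) (shifte k e).

Record crystal (R : realType) := Crystal {
  nv : nat;
  joint0 : 'I_nv -> 'rV[R]_3;
  trans_a : 'rV[R]_3;
  trans_b : 'rV[R]_3;
  trans_c : 'rV[R]_3;
  Fe : {fset edge nv};
  trans_free : free [:: trans_a; trans_b; trans_c];
  (* the set of framework points is the disjoint union of the T_k(F_v), and
     F_v has nv elements *)
  joint_inj : injective (fun v : vertex nv =>
    translate trans_a trans_b trans_c v.2 (joint0 v.1));
  edge_noloop : forall e, e \in Fe -> e.1 <> e.2;
  edge_touch : forall e, e \in Fe -> e.1.2 = 0 \/ e.2.2 = 0;
  (* a reflexive edge is written [p_{kappa,0}, p_{kappa,delta}] *)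
  edge_refl : forall e, e \in Fe -> reflexive_edge e -> e.1.2 = 0;
  (* the T_k(Fe) are disjoint, and Fe lists each of its edges once *)
  edge_disjoint : forall e e' k k', e \in Fe -> e' \in Fe ->
    same_edge (shifte k e) (shifte k' e') -> e = e' /\ k = k';
  connected_crystal : forall v w : vertex nv,
    exists2 s : seq (vertex nv),
      path (fun x y => `[< adjacent Fe x y >]) v s & last v s = w
}.

Definition Ja (R : realType) (C : crystal R) : finType :=
  ('I_(nv C) * 'I_3)%type.
Definition Jb (R : realType) (C : crystal R) : finType := Fe C.

Definition joint (R : realType) (C : crystal R) (v : vertex (nv C)) : 'rV[R]_3 :=
  translate (trans_a C) (trans_b C) (trans_c C) v.2 (joint0 v.1).

Definition bar (R : realType) (C : crystal R) (e : edge (nv C)) (s : 'I_3) : R[i] :=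
  ((joint e.1 - joint e.2) 0 s)%:C.

Definition mono (R : realType) (z : 'rV[R[i]]_3) (k : Z3) : R[i] :=
  \prod_(i < 3) z 0 i ^ k 0 i.

Definition Phi_entry (R : realType) (C : crystal R) (z : 'rV[R[i]]_3)
    (e : edge (nv C)) (j : Ja C) : R[i] :=
  if reflexive_edge e then
    if j.1 == e.1.1 then bar e j.2 * (1 - (mono z e.2.2)^*%R) else 0
  else if j.1 == e.1.1 then bar e j.2 * (mono z e.1.2)^*%R
  else if j.1 == e.2.1 then - bar e j.2 * (mono z e.2.2)^*%R
  else 0.

(* C^J is represented by column vectors indexed by the enumeration of J. *)
Definition Phi (R : realType) (C : crystal R) (z : 'rV[R[i]]_3) :
    'M[R[i]]_(#|Jb C|, #|Ja C|) :=
  \matrix_(e, j) Phi_entry z (val (enum_val e)) (enum_val j).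

(* The coordinate (u_{kappa,k})_sigma is [u ((kappa, sigma), k)]. *)
Definition rigidity (R : realType) (C : crystal R)
    (u : Ja C * Z3 -> R[i]) : Jb C * Z3 -> R[i] :=
  fun ek => let: (a, b) := shifte ek.2 (val ek.1) in
    \sum_(s < 3) bar (a, b) s * (u ((a.1, s), a.2) - u ((b.1, s), b.2)).

Record period := Period { per :> 'I_3 -> nat; per_gt0 : forall i, (0 < per i)%N }.

Definition box (r : period) : finType := {dffun forall i : 'I_3, 'I_(r i)}.

Lemma card_box (r : period) : #|box r| = (\prod_(i < 3) r i)%N.
Proof.
rewrite card_dep_ffun foldrE big_map -big_enum.
by apply: eq_bigr => i _; rewrite card_ord.
Qed.

Definition boxZ (r : period) (k : box r) : Z3 := \row_i (k i : nat)%:Z.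

Definition eqmodp (r : period) (k k' : Z3) : bool :=
  [forall i : 'I_3, (k 0%R i == k' 0%R i %[mod (r i)%:Z])%Z].

(* exp (2 i pi / r_i) *)
Definition omega (R : realType) (r : period) (i : 'I_3) : R[i] :=
  cos (2 * pi / (r i)%:R) +i* sin (2 * pi / (r i)%:R).

Definition omega_pow (R : realType) (r : period) (k : box r) : 'rV[R[i]]_3 :=
  \row_i omega R r i ^+ k i.

Definition torus (R : realType) (r : period) : finType :=
  seq_sub (codom (@omega_pow R r)).

Section Periodic.
Variables (R : realType) (r : period) (J : finType).

Definition periodic (u : J * Z3 -> R[i]) : Prop :=
  forall m : Z3, (forall i, ((r i)%:Z %| m 0%R i)%Z) ->
  forall j k, u (j, k + m) = u (j, k).

Definition periodic_pred : {pred J * Z3 -> R[i]^o} :=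
  fun u => `[< periodic u >].

Fact periodic_submod : submod_closed periodic_pred.
Proof.
split=> [|a u v]; first by apply/asboolP.
move=> /asboolP pu /asboolP pv; apply/asboolP => m hm j k.
rewrite !fctE; congr (_ + _); last exact: pv.
by congr (_ *: _); exact: pu.
Qed.
HB.instance Definition _ :=
  GRing.isSubmodClosed.Build _ _ periodic_pred periodic_submod.

(* K^r_a is [Kper R r (Ja C)] and K^r_b is [Kper R r (Jb C)]. *)
Record Kper := KPer { kper : J * Z3 -> R[i]^o; _ : kper \in periodic_pred }.
HB.instance Definition _ := [isSub for kper].
HB.instance Definition _ := [Choice of Kper by <:].
HB.instance Definition _ := [SubChoice_isSubZmodule of Kper by <:].
HB.instance Definition _ := [SubZmodule_isSubLmodule of Kper by <:].

Definition kper_fun (u : Kper) : J * Z3 -> R[i] := kper u.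
Coercion kper_fun : Kper >-> Funclass.
Arguments kper_fun : simpl never.

Lemma kperP (u : Kper) : periodic u.
Proof. by apply/asboolP; exact: (valP u). Qed.

Fact box_subproof (k : Z3) (i : 'I_3) : (`|(k 0%R i %% (r i)%:Z)%Z| < r i)%N.
Proof.
have r0 : (0 : int) < (r i)%:Z by exact: per_gt0.
by rewrite -ltz_nat gez0_abs ?modz_ge0 ?ltz_pmod // gt_eqF.
Qed.

Definition box_of (k : Z3) : box r := [ffun i => Ordinal (box_subproof k i)].

Lemma boxZ_of k i : boxZ (box_of k) 0 i = (k 0%R i %% (r i)%:Z)%Z.
Proof.
rewrite mxE ffunE /= gez0_abs // modz_ge0 // gt_eqF //.
exact: per_gt0.
Qed.

Lemma box_ofK : cancel (@boxZ r) box_of.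
Proof.
move=> k; apply/ffunP => i; apply/val_inj/(can_inj absz_nat).
have := boxZ_of (boxZ k) i; rewrite !mxE => ->.
by rewrite modz_small // lez_nat /= ltz_nat ltn_ord.
Qed.

Lemma box_of_per (m k : Z3) : (forall i, ((r i)%:Z %| m 0%R i)%Z) ->
  box_of (k + m) = box_of k.
Proof.
move=> hm; apply/ffunP => i; apply/val_inj; rewrite !ffunE /= mxE.
by have /dvdzP[q ->] := hm i; rewrite addrC modzMDl.
Qed.

Lemma kper_box (u : Kper) j k : u (j, boxZ (box_of k)) = u (j, k).
Proof.
rewrite -[in RHS](subrK (boxZ (box_of k)) k) addrC kperP // => i.
rewrite mxE [X in _ + X]mxE boxZ_of {1}(divz_eq (k 0 i) (r i)) addrK.
exact: dvdz_mull.
Qed.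

Definition kper_row (u : Kper) : 'rV[R[i]]_#|{: J * box r}| :=
  \row_p u ((enum_val p).1, boxZ (enum_val p).2).

Fact row_kper_subproof (v : 'rV[R[i]]_#|{: J * box r}|) :
  (fun jk : J * Z3 => v 0 (enum_rank (jk.1, box_of jk.2)) : R[i]^o)
    \in periodic_pred.
Proof. by apply/asboolP => m hm j k /=; rewrite box_of_per. Qed.

Definition row_kper v : Kper := KPer (row_kper_subproof v).

Fact kper_vect_iso : Vector.axiom #|{: J * box r}| Kper.
Proof.
exists kper_row; first by move=> a u v; apply/rowP => p; rewrite !mxE.
exists row_kper => [u|v].
  by apply/val_inj/funext => -[j k] /=; rewrite mxE enum_rankK kper_box.
apply/rowP => p; rewrite mxE /kper_fun /= box_ofK -surjective_pairing.
by rewrite enum_valK.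
Qed.
HB.instance Definition _ := Lmodule_hasFinDim.Build R[i] Kper kper_vect_iso.

Definition basis_fun (j : J) (k : box r) : J * Z3 -> R[i] :=
  fun jk => ((jk.1 == j) && eqmodp r jk.2 (boxZ k))%:R.

Fact basis_subproof j k : basis_fun j k \in periodic_pred.
Proof.
apply/asboolP => m hm j' k'; rewrite /basis_fun /=; congr (_ && _)%:R.
apply: eq_forallb => i; rewrite mxE.
by have /dvdzP[q ->] := hm i; rewrite addrC modzMDl.
Qed.

(* The vectors written xi and eta with a dot. *)
Definition basis (j : J) (k : box r) : Kper := KPer (basis_subproof j k).

(* The inner product for which the vectors [basis j k] are orthonormal. *)
Definition dotK (u v : Kper) : R[i] :=
  \sum_(j : J) \sum_(k : box r) u (j, boxZ k) * (v (j, boxZ k))^*%R.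

Lemma basisE j j' k k' : basis j k (j', boxZ k') = ((j' == j) && (k' == k))%:R.
Proof.
congr (_ && _)%:R; apply/forallP/eqP => [h|-> //].
rewrite -[k']box_ofK -[k]box_ofK; apply/ffunP => i; apply/val_inj.
by rewrite !ffunE /= (eqP (h i)).
Qed.

Lemma basis_orthonormal j j' k k' :
  dotK (basis j k) (basis j' k') = ((j == j') && (k == k'))%:R.
Proof.
rewrite /dotK (bigD1 j) //= (bigD1 k) //= big1 => [|k1 /negPf nk].
  rewrite big1 => [|j1 /negPf nj].
    by rewrite !basisE !eqxx mul1r !addr0 conjC_nat.
  by rewrite big1 // => k1 _; rewrite !basisE nj mul0r.
by rewrite !basisE nk andbF mul0r.
Qed.

Lemma kper_sumE (I : finType) (F : I -> Kper) x :
  (\sum_i F i : Kper) x = \sum_i F i x.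
Proof. by rewrite -[LHS]/(val (\sum_i F i) x) raddf_sum fct_sumE. Qed.

Lemma kperZE a (u : Kper) x : (a *: u) x = a * u x.
Proof. by []. Qed.

Lemma basis_combE (c : J -> box r -> R[i]) j k :
  (\sum_(j' : J) \sum_(k' : box r) c j' k' *: basis j' k' : Kper) (j, boxZ k)
    = c j k.
Proof.
rewrite kper_sumE (bigD1 j) //= kper_sumE (bigD1 k) //= kperZE basisE !eqxx mulr1.
rewrite big1 => [|k1 nk]; last first.
  by rewrite kperZE basisE [k == _]eq_sym (negPf nk) andbF mulr0.
rewrite big1 ?addr0 // => j1 nj; rewrite kper_sumE big1 // => k1 _.
by rewrite kperZE basisE [j == _]eq_sym (negPf nj) mulr0.
Qed.

Lemma basis_sum (u : Kper) :
  u = \sum_(j : J) \sum_(k : box r) u (j, boxZ k) *: basis j k.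
Proof.
apply/val_inj/funext => -[j k].
rewrite -[LHS]/(u (j, k)) -[RHS]/((\sum_j0 \sum_k0 _ : Kper) (j, k)).
by rewrite -kper_box -[RHS]kper_box basis_combE.
Qed.

End Periodic.
Arguments kper_fun : simpl never.

Section L2.
Variables (R : realType) (r : period) (J : finType).

Definition L2 : vectType R[i] := {ffun torus R r -> 'cV[R[i]]_#|J|}.

(* normalised counting measure on the torus, standard inner product on C^J *)
Definition dotL (F G : L2) : R[i] :=
  #|torus R r|%:R^-1 *
  \sum_(w : torus R r) \sum_(j < #|J|) F w j 0 * (G w j 0)^*%R.

Definition xi (j : J) : 'cV[R[i]]_#|J| := delta_mx (enum_rank j) 0.

Definition monoL (j : J) (k : box r) : L2 :=
  [ffun w => mono (val w) (boxZ k) *: xi j].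

(* Linear extension of [basis j k |-> monoL j k]; see [U_basis]. *)
Definition Ufun (u : Kper R r J) : L2 :=
  \sum_(j : J) \sum_(k : box r) u (j, boxZ k) *: monoL j k.

Fact Ufun_linear : linear Ufun.
Proof.
move=> a u v; rewrite /Ufun scaler_sumr -big_split; apply: eq_bigr => j _.
rewrite scaler_sumr -big_split; apply: eq_bigr => k _ /=.
by rewrite scalerA -scalerDl.
Qed.
HB.instance Definition _ := GRing.isLinear.Build R[i] (Kper R r J) L2 _ Ufun
  Ufun_linear.

Definition U : 'Hom(Kper R r J, L2) := linfun Ufun.

Lemma U_basis j k : U (basis R j k) = monoL j k.
Proof.
rewrite lfunE /= /Ufun (bigD1 j) //= (bigD1 k) //= basisE !eqxx scale1r.
rewrite big1 => [|k1 /negPf nk]; last by rewrite basisE nk andbF scale0r.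
rewrite big1 => [|j1 /negPf nj]; first by rewrite !addr0.
by rewrite big1 // => k1 _; rewrite basisE nj scale0r.
Qed.

(* Hilbert space adjoint, computed in the orthonormal basis [basis j k];
   see [adjointP]. *)
Definition adjfun (f : 'Hom(Kper R r J, L2)) (F : L2) : Kper R r J :=
  \sum_(j : J) \sum_(k : box r) dotL F (f (basis R j k)) *: basis R j k.

Lemma dotLZDl a (F G H : L2) : dotL (a *: F + G) H = a * dotL F H + dotL G H.
Proof.
rewrite /dotL mulrCA -mulrDr; congr (_ * _).
rewrite mulr_sumr -big_split; apply: eq_bigr => w _.
rewrite mulr_sumr -big_split; apply: eq_bigr => j _ /=.
by rewrite !ffunE !mxE mulrDl mulrA.
Qed.

Lemma dotLC (F G : L2) : dotL G F = (dotL F G)^*%R.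
Proof.
rewrite /dotL rmorphM fmorphV rmorph_nat; congr (_ * _).
rewrite rmorph_sum; apply: eq_bigr => w _; rewrite rmorph_sum.
by apply: eq_bigr => j _; rewrite rmorphM /= conjCK mulrC.
Qed.

Fact adjfun_linear f : linear (adjfun f).
Proof.
move=> a F G; rewrite /adjfun scaler_sumr -big_split; apply: eq_bigr => j _.
rewrite scaler_sumr -big_split; apply: eq_bigr => k _ /=.
by rewrite dotLZDl scalerDl scalerA.
Qed.
HB.instance Definition _ f := GRing.isLinear.Build R[i] L2 (Kper R r J) _
  (adjfun f) (adjfun_linear f).

Definition adjoint (f : 'Hom(Kper R r J, L2)) : 'Hom(L2, Kper R r J) :=
  linfun (adjfun f).

Lemma adjfunE (f : 'Hom(Kper R r J, L2)) F j k :
  adjfun f F (j, boxZ k) = dotL F (f (basis R j k)).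
Proof. exact: basis_combE. Qed.

Lemma adjointP (f : 'Hom(Kper R r J, L2)) u F :
  dotL (f u) F = dotK u (adjoint f F).
Proof.
have dotL0 : dotL 0 F = 0.
  by have := dotLZDl (- 1) 0 0 F; rewrite scaler0 addr0 mulN1r addNr.
have dotLD G H : dotL (G + H) F = dotL G F + dotL H F.
  by rewrite -{1}[G]scale1r dotLZDl mul1r.
have dotLZ a G : dotL (a *: G) F = a * dotL G F.
  by rewrite -[a *: G]addr0 dotLZDl dotL0 addr0.
rewrite {1}(basis_sum u) linear_sum (big_morph (fun G => dotL G F) dotLD dotL0).
apply: eq_bigr => j _.
rewrite linear_sum (big_morph (fun G => dotL G F) dotLD dotL0).
apply: eq_bigr => k _; rewrite linearZ dotLZ lfunE adjfunE /=.
by rewrite -dotLC.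
Qed.

Definition unitary (f : 'Hom(Kper R r J, L2)) : Prop :=
  (adjoint f \o f = \1)%VF /\ (f \o adjoint f = \1)%VF.

End L2.

Section Maps.
Variables (R : realType) (C : crystal R) (r : period).

Fact rigidity_periodic (u : Kper R r (Ja C)) :
  (rigidity u : Jb C * Z3 -> R[i]^o) \in @periodic_pred R r (Jb C).
Proof.
apply/asboolP => m hm e k; rewrite /rigidity /=; apply: eq_bigr => s _.
congr (_ * (_ - _)).
- by rewrite /bar /joint /translate /= !mxE; congr (_%:C); rewrite !rmorphD /=; ring.
- by rewrite addrA (kperP u).
- by rewrite addrA (kperP u).
Qed.

Definition rigidity_perfun (u : Kper R r (Ja C)) : Kper R r (Jb C) :=
  KPer (rigidity_periodic u).

Fact rigidity_perfun_linear : linear rigidity_perfun.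
Proof.
move=> a u v; apply/val_inj/funext => -[e k] /=.
rewrite -[RHS]/(a * rigidity u (e, k) + rigidity v (e, k)) /rigidity /=.
rewrite mulr_sumr -big_split; apply: eq_bigr => s _ /=.
by rewrite -[(a *: u + v) _]/(a * u _ + v _) -[(a *: u + v) _]/(a * u _ + v _); ring.
Qed.
HB.instance Definition _ := GRing.isLinear.Build R[i] _ _ _ rigidity_perfun
  rigidity_perfun_linear.

Definition rigidity_per : 'Hom(Kper R r (Ja C), Kper R r (Jb C)) :=
  linfun rigidity_perfun.

Definition multfun (F : L2 R r (Ja C)) : L2 R r (Jb C) :=
  [ffun w => Phi C (val w) *m F w].

Fact multfun_linear : linear multfun.
Proof.
move=> a F G; apply/ffunP => w.
by rewrite !ffunE mulmxDr scalemxAr.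
Qed.
HB.instance Definition _ := GRing.isLinear.Build R[i] _ _ _ multfun
  multfun_linear.

Definition multPhi : 'Hom(L2 R r (Ja C), L2 R r (Jb C)) := linfun multfun.

End Maps.

Definition mulmx_hom (K : fieldType) m n (A : 'M[K]_(m, n)) :
  'Hom('cV[K]_n, 'cV[K]_m) := linfun (mulmx A).

(* Main.v *)
(* The functions w |-> w^k, for k in the period box, are the characters of the
   finite torus, so they are orthonormal and U_a, U_b are unitary.  In these
   Fourier coordinates a translation of the index by d is multiplication by the
   conjugate of w^d, which is exactly how the columns of Phi combine the
   displacements of the two ends of an edge; hence U_b R^(r) = M_Phi U_a.
   The kernel of a multiplication operator on a finite set is the direct sum of
   the pointwise kernels. *)
Require Import Defs.
From HB Require Import structures.
From mathcomp Require Import all_boot all_order all_algebra finmap.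
From mathcomp Require Import all_classical all_reals all_analysis.
From mathcomp Require Import complex.
From mathcomp Require Import ring lra.

Set Implicit Arguments.
Unset Strict Implicit.
Unset Printing Implicit Defensive.

Import Order.TTheory GRing.Theory Num.Theory.
Local Open Scope ring_scope.
Local Open Scope complex_scope.

(** * Roots of unity *)

Lemma deMoivre (R : realType) (t : R) n :
  (cos t +i* sin t) ^+ n = cos (t *+ n) +i* sin (t *+ n).
Proof.
elim: n => [|n IHn]; first by rewrite expr0 mulr0n cos0 sin0.
rewrite exprS IHn mulrS cosD sinD /GRing.mul /=.
by congr (_ +i* _); rewrite addrC.
Qed.

(** Let [y] be half the argument of [omega ^+ m.+1]. This power equals 1 only if [cos (y *+ 2) = 1],
    which forces [sin y = 0]. Since [0 < y <= pi], only [y = pi] remains, that is [m.+1 = r i]. *)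
Lemma omega_prim (R : realType) (r : period) i :
  (r i).-primitive_root (omega R r i).
Proof.
have r_gt0 := per_gt0 r i; have rR : 0 < (r i)%:R :> R by rewrite ltr0n.
rewrite /primitive_root_of_unity r_gt0; apply/forallP => m; apply/eqP.
rewrite unity_rootE /omega deMoivre; set y := pi * m.+1%:R / (r i)%:R : R.
have -> : 2 * pi / (r i)%:R *+ m.+1 = y *+ 2.
  by rewrite -mulr_natr -[RHS]mulr_natr /y; ring.
have [mr | mr] := eqVneq m.+1 (r i).
  have -> : y = pi by rewrite /y mr mulfK // gt_eqF.
  by rewrite cos2pi sin_mulr2n sinpi mulr0 mul0rn eqxx.
apply/negP; rewrite eq_complex => /andP[/= /eqP + _].
rewrite cos_mulr2n => cy.
suff : 0 < sin y.
  suff -> : sin y = 0 by rewrite ltxx.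
  by apply/eqP; rewrite -sqrf_eq0 sin2cos2; apply/eqP; lra.
apply: sin_gt0_pi; rewrite /y divr_gt0 ?mulr_gt0 ?pi_gt0 ?ltr0n //=.
rewrite ltr_pdivrMr // ltr_pM2l ?pi_gt0 // ltr_nat ltn_neqAle mr.
exact: ltn_ord.
Qed.

Lemma normr_prim_root (R : numDomainType) n (z : R) :
  n.-primitive_root z -> `|z| = 1.
Proof.
move=> zP; apply/eqP; have := pexprn_eq1 n (normr_ge0 z).
rewrite -normrX prim_expr_order // normr1 eqxx.
by rewrite gtn_eqF ?(prim_order_gt0 zP) //= => /esym.
Qed.

(** * Orthogonality of the characters of the finite torus *)

Section Characters.
Variables (R : realType) (r : period).
Implicit Types (z : 'rV[R[i]]_3) (k m : Z3) (l : box r).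

(** The first condition makes monomials depend only on exponents modulo [r]; the second makes
    conjugation inversion. Unlike the type [torus], this predicate applies directly to a
    coordinatewise quotient of torus points. *)
Definition on_torus z := forall i, z 0 i ^+ r i = 1 /\ `|z 0 i| = 1.

Lemma on_torus_omega_pow l : on_torus (omega_pow R l).
Proof.
move=> i; rewrite mxE exprAC (prim_expr_order (omega_prim R r i)) expr1n.
by rewrite normrX (normr_prim_root (omega_prim R r i)) expr1n.
Qed.

Lemma on_torus_val (w : torus R r) : on_torus (val w).
Proof. by have /codomP[l ->] := valP w; exact: on_torus_omega_pow. Qed.

Lemma on_torus_neq0 z i : on_torus z -> z 0 i != 0.
Proof. by move=> /(_ i)[_ z1]; rewrite -normr_eq0 z1 oner_neq0. Qed.

Lemma monoD z k m : on_torus z -> mono z (k + m) = mono z k * mono z m.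
Proof.
move=> zT; rewrite /mono -big_split; apply: eq_bigr => i _ /=.
by rewrite mxE expfzDr // on_torus_neq0.
Qed.

Lemma mono_per z k m : on_torus z -> (forall i, ((r i)%:Z %| m 0%R i)%Z) ->
  mono z (k + m) = mono z k.
Proof.
move=> zT hm; rewrite monoD // [mono z m]big1 ?mulr1 // => i _.
have /dvdzP[q ->] := hm i; rewrite mulrC -exprz_exp -exprnP.
by rewrite (zT i).1 exp1rz.
Qed.

Lemma mono_conjM z k : on_torus z -> mono z k * (mono z k)^*%R = 1.
Proof.
move=> zT; rewrite /mono rmorph_prod -big_split big1 // => i _ /=.
rewrite -normCK (_ : `|_| = 1) ?expr1n //.
by case: (k 0 i) => n; rewrite ?NegzE -?exprnP ?exprnN ?normfV normrX (zT i).2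
  expr1n ?invr1.
Qed.

Lemma boxZ_of_dvd k i : ((r i)%:Z %| (boxZ (box_of r k) - k) 0%R i)%Z.
Proof.
rewrite mxE [X in _ + X]mxE boxZ_of {2}(divz_eq (k 0 i) (r i)) opprD addrCA.
by rewrite subrr addr0 -mulNr dvdz_mull.
Qed.

Lemma box_of_add k m : box_of r (boxZ (box_of r k) + m) = box_of r (k + m).
Proof.
by rewrite -(box_of_per (k + m) (boxZ_of_dvd k)) [in RHS]addrC addrA subrK.
Qed.

(** Translation by [m] followed by reduction modulo [r] permutes the box; the inverse is translation
    by [- m]. *)
Lemma box_shift (h : Z3 -> R[i]) m :
  (forall k, h (boxZ (box_of r k)) = h k) ->
  \sum_(l : box r) h (boxZ l + m) = \sum_(l : box r) h (boxZ l).
Proof.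
move=> hper; rewrite [RHS](reindex (fun l => box_of r (boxZ l + m))) /=.
  by apply: eq_bigr => l _; rewrite hper.
exists (fun l => box_of r (boxZ l - m)) => l _;
  by rewrite box_of_add ?addrK ?subrK box_ofK.
Qed.

Lemma mono_box z k : on_torus z -> mono z (boxZ (box_of r k)) = mono z k.
Proof.
move=> zT; rewrite -[boxZ _](subrK k) addrC mono_per // => i; exact: boxZ_of_dvd.
Qed.

(* If z_i <> 1, the shift by the i-th unit vector multiplies the sum by z_i. *)
Lemma sum_mono z i : on_torus z -> z 0 i != 1 ->
  \sum_(l : box r) mono z (boxZ l) = 0.
Proof.
move=> zT zi.
have := box_shift (h := mono z) (delta_mx 0 i) (fun k => mono_box k zT).
under eq_bigr do rewrite monoD //.
have -> : mono z (delta_mx 0 i) = z 0 i.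
  rewrite /mono (bigD1 i) //= mxE !eqxx expr1z big1 ?mulr1 // => j /negPf ji.
  by rewrite mxE ji andbF expr0z.
rewrite -mulr_suml => /eqP; rewrite -subr_eq0 -{2}[\sum_l _]mulr1 -mulrBr.
by rewrite mulf_eq0 subr_eq0 (negPf zi) orbF => /eqP.
Qed.

Lemma omega_pow_inj : injective (@omega_pow R r).
Proof.
move=> l l' e; apply/ffunP => i; apply/val_inj/eqP.
have /eqP := congr1 (fun z : 'rV_3 => z 0 i) e; rewrite !mxE.
by rewrite (eq_prim_root_expr (omega_prim R r i)) !modn_small.
Qed.

Definition torus_pt l : torus R r := SeqSub (codom_f (@omega_pow R r) l).

(** This turns sums over the torus into sums over the box, both for orthogonality and for the final
    dimension count. *)
Lemma torus_pt_bij : bijective torus_pt.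
Proof.
have pinj : injective torus_pt by move=> l l' [] /omega_pow_inj.
apply: inj_card_bij => //; rewrite card_seq_sub ?size_codom //.
by apply/injectiveP; exact: omega_pow_inj.
Qed.

Lemma card_torus : #|torus R r| = #|box r|.
Proof. by rewrite (bij_eq_card torus_pt_bij). Qed.

Lemma card_torus_neq0 : #|torus R r|%:R != 0 :> R[i].
Proof. by rewrite pnatr_eq0 -lt0n card_torus card_box prodn_gt0 // => i; exact: per_gt0. Qed.

Lemma mono_orthonormal l l' :
  #|torus R r|%:R^-1 *
    \sum_(w : torus R r) mono (val w) (boxZ l) * (mono (val w) (boxZ l'))^*%R
  = (l == l')%:R :> R[i].
Proof.
have [<-|ll'] := eqVneq l l'.
  rewrite (eq_bigr (fun=> 1)) => [|w _]; last exact: mono_conjM _ (on_torus_val w).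
  by rewrite sumr_const -[1 *+ _]/(_%:R) mulVf // card_torus_neq0.
rewrite (reindex torus_pt) /=; last exact: onW_bij torus_pt_bij.
(* Points and exponents are dual: the [l]-th monomial at [omega^m] is the [m]-th monomial at
   [omega^l]. The sum over the torus thus becomes the sum of all monomials at the quotient [z] of
   [omega^l] by [omega^l']. *)
pose z : 'rV[R[i]]_3 := \row_i (omega_pow R l 0 i * (omega_pow R l' 0 i)^*%R).
have zE i : z 0 i = omega_pow R l 0 i * (omega_pow R l' 0 i)^*%R by rewrite mxE.
have zT : on_torus z.
  move=> i; have [[a b] [a' b']] := (on_torus_omega_pow l i, on_torus_omega_pow l' i).
  by rewrite zE exprMn -rmorphXn a a' rmorph1 mulr1 normrM norm_conjC b b' mulr1.
(* If every coordinate of [z] were 1, the unimodular points [omega^l] and [omega^l'] would coincide,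
   against the injectivity of [omega_pow]. *)
have [i zi] : exists i, z 0 i != 1.
  apply/existsP; apply: contraNT ll'; rewrite negb_exists => /forallP zP.
  apply/eqP/omega_pow_inj/rowP => i; have /negPn/eqP := zP i; rewrite zE => zi.
  have [_ n1] := on_torus_omega_pow l' i.
  by rewrite -[LHS]mulr1 -(expr1n _ 2) -n1 normCKC mulrA zi mul1r.
rewrite -[RHS](mulr0 (#|torus R r|%:R^-1)); congr (_ * _).
rewrite -[RHS](sum_mono zT zi); apply: eq_bigr => m _.
rewrite /mono rmorph_prod -big_split; apply: eq_bigr => j _ /=.
rewrite !mxE -!exprnP !rmorphXn exprMn -!exprM.
by congr (_ * _); rewrite mulnC.
Qed.
End Characters.

(** * The finite Fourier transform [U] and its unitarity *)

Section Unitarity.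
Variables (R : realType) (r : period) (J : finType).

Lemma basis_ext (vT : vectType R[i]) (f g : 'Hom(Kper R r J, vT)) :
  (forall j k, f (Defs.basis R j k) = g (Defs.basis R j k)) -> f = g.
Proof.
move=> fg; apply/lfunP => u; rewrite (basis_sum u) !linear_sum.
apply: eq_bigr => j _; rewrite !linear_sum; apply: eq_bigr => k _.
by rewrite linearZ [RHS]linearZ; congr (_ *: _); exact: fg.
Qed.

Lemma xi_orthonormal (j j' : J) :
  \sum_(i < #|J|) xi R j i 0 * (xi R j' i 0)^*%R = (j == j')%:R.
Proof.
rewrite (bigD1 (enum_rank j)) //= big1 => [|i /negPf ij].
  by rewrite !mxE !eqxx mul1r addr0 andbT conjC_nat (inj_eq enum_rank_inj).
by rewrite mxE ij mul0r.
Qed.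

(** The inner product factors into that of two characters and that of two standard basis vectors. *)
Lemma monoL_orthonormal (j j' : J) (k k' : box r) :
  dotL (monoL R j k) (monoL R j' k') = ((j == j') && (k == k'))%:R.
Proof.
rewrite -mulnb natrM mulrC -mono_orthonormal -mulrA; congr (_ * _).
rewrite mulr_suml; apply: eq_bigr => w _; rewrite -xi_orthonormal mulr_sumr.
apply: eq_bigr => i _; rewrite !ffunE !mxE rmorphM; ring.
Qed.

(** In the orthonormal basis, the matrix of this composite is the Gram matrix of the family
    [monoL]. *)
Lemma adjoint_U_comp : (adjoint (U R r J) \o U R r J = \1)%VF.
Proof.
apply: basis_ext => j k; rewrite comp_lfunE id_lfunE U_basis [LHS]lfunE /=.
rewrite /adjfun (bigD1 j) //= (bigD1 k) //= U_basis monoL_orthonormal !eqxx.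
rewrite scale1r big1 => [|k1 nk]; last first.
  by rewrite U_basis monoL_orthonormal [k == _]eq_sym (negPf nk) andbF scale0r.
rewrite big1 ?addr0 // => j1 nj; rewrite big1 // => k1 _.
by rewrite U_basis monoL_orthonormal [j == _]eq_sym (negPf nj) scale0r.
Qed.

(* The two spaces have dimension |J| r_1 r_2 r_3, so a left inverse of [U] is
   also a right inverse. *)
Lemma unitary_U : unitary (U R r J).
Proof.
split; first exact: adjoint_U_comp.
have UK u : adjoint (U R r J) (U R r J u) = u.
  by rewrite -comp_lfunE adjoint_U_comp id_lfunE.
have kerU : (fullv :&: lker (U R r J) = 0)%VS.
  apply/eqP; rewrite -subv0; apply/subvP => u; rewrite memv_cap memv_ker.
  by move=> /andP[_ /eqP Uu]; rewrite -[u]UK Uu linear0 mem0v.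
have imU : limg (U R r J) = fullv.
  apply/eqP; rewrite eqEdim subvf (limg_dim_eq kerU) !dimvf.
  have -> : dim (L2 R r J) = (#|torus R r| * (#|J| * 1))%N by [].
  have -> : dim (Kper R r J) = #|{: J * box r}| by [].
  by rewrite card_prod card_torus muln1 mulnC leqnn.
apply/lfunP => F; have : F \in limg (U R r J) by rewrite imU memvf.
by move=> /memv_imgP[u _ ->]; rewrite comp_lfunE UK id_lfunE.
Qed.

Lemma U_coord (u : Kper R r J) w j :
  U R r J u w (enum_rank j) 0 =
    \sum_(k : box r) u (j, boxZ k) * mono (val w) (boxZ k).
Proof.
rewrite lfunE /= /Ufun sum_ffunE summxE (bigD1 j) //= [X in _ + X]big1.
  rewrite addr0 sum_ffunE summxE; apply: eq_bigr => k _.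
  by rewrite !ffunE !mxE !eqxx mulr1.
move=> j' nj; rewrite sum_ffunE summxE big1 // => k _; rewrite !ffunE !mxE.
by rewrite (inj_eq enum_rank_inj) eq_sym (negPf nj) !mulr0.
Qed.

Lemma U_shift (u : Kper R r J) w j d :
  \sum_(k : box r) u (j, d + boxZ k) * mono (val w) (boxZ k) =
    (mono (val w) d)^*%R * U R r J u w (enum_rank j) 0.
Proof.
have wT := on_torus_val w.
rewrite U_coord -(box_shift (h := fun x => u (j, x) * mono (val w) x) d); last first.
  by move=> k; rewrite kper_box (mono_box _ wT).
rewrite mulr_sumr; apply: eq_bigr => k _; rewrite (monoD _ _ wT) addrC.
by rewrite mulrCA [_^*%R * _]mulrC -[in RHS]mulrA (mono_conjM _ wT) mulr1.
Qed.
End Unitarity.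

(** * The rigidity map in Fourier coordinates *)

Section Intertwining.
Variables (R : realType) (C : crystal R) (r : period).

Lemma barD (e : edge (nv C)) k s : bar (shifte k e) s = bar e s.
Proof.
rewrite /bar /joint /translate /= !mxE; congr (_%:C).
by rewrite !rmorphD /=; ring.
Qed.

(** One formula covers both kinds of row: a reflexive edge has first index 0, so the 1 in its entry
    is the conjugate of [w^0], and the contributions of its two ends merge in a single column. *)
Lemma Phi_entry_sum (w : torus R r) (e : edge (nv C)) s (f : 'I_(nv C) -> R[i]) :
  e \in Fe C ->
  \sum_k Phi_entry (val w) e (k, s) * f k =
  bar e s * ((mono (val w) e.1.2)^*%R * f e.1.1 -
             (mono (val w) e.2.2)^*%R * f e.2.1).
Proof.
move=> eFe; rewrite /Phi_entry /=.
case er: (reflexive_edge e).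
  have m0 : mono (val w) 0 = 1.
    by rewrite /mono big1 // => i _; rewrite mxE expr0z.
  rewrite (bigD1 e.1.1) //= eqxx big1 => [|k /negPf ->]; last by rewrite mul0r.
  by rewrite (edge_refl eFe er) m0 rmorph1 -(eqP er); ring.
rewrite (bigD1 e.1.1) //= eqxx (bigD1 e.2.1) /=; last by rewrite eq_sym [_ == _]er.
rewrite eq_sym [_ == _]er eqxx big1 => [|k /andP[/negPf -> /negPf ->]].
  by ring.
by rewrite mul0r.
Qed.

Lemma rigidity_intertwine :
  (U R r (Jb C) \o rigidity_per C r = multPhi C r \o U R r (Ja C))%VF.
Proof.
apply/lfunP => u; rewrite !comp_lfunE /rigidity_per /multPhi.
rewrite [in LHS](lfunE (@rigidity_perfun R C r)) [RHS]lfunE /=.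
apply/ffunP => w; rewrite [RHS]ffunE; apply/matrixP => p q.
rewrite ord1 -[p]enum_valK; set e := enum_val p; rewrite U_coord mxE.
rewrite (reindex enum_rank) /=; last exact: onW_bij (enum_rank_bij _).
pose hat k s := U R r (Ja C) u w (enum_rank (k, s)) 0.
transitivity (\sum_(j : Ja C) Phi_entry (val w) (val e) j * hat j.1 j.2); last first.
  by apply: eq_bigr => -[k s] _; rewrite mxE !enum_rankK.
rewrite -(pair_bigA _ (fun k s => Phi_entry (val w) (val e) (k, s) * hat k s)).
rewrite exchange_big /=.
(* By [barD] the bar vector is the same in every cell, so the Fourier sum of the bond sequence
   splits into one shifted sum per end, which [U_shift] evaluates. *)
transitivity (\sum_(s < 3) bar (val e) s *
   (\sum_(k : box r) u (((val e).1.1, s), (val e).1.2 + boxZ k) * mono (val w) (boxZ k) -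
    \sum_(k : box r) u (((val e).2.1, s), (val e).2.2 + boxZ k) * mono (val w) (boxZ k))).
  under eq_bigr do rewrite mulr_suml.
  rewrite exchange_big; apply: eq_bigr => s _ /=.
  rewrite -sumrB mulr_sumr; apply: eq_bigr => k _.
  rewrite -[(_, _)]/(shifte (boxZ k) (val e)) barD; ring.
by apply: eq_bigr => s _; rewrite (Phi_entry_sum _ _ _ (fsvalP e)) !U_shift.
Qed.

Lemma rigidity_factor :
  rigidity_per C r =
    (adjoint (U R r (Jb C)) \o multPhi C r \o U R r (Ja C))%VF.
Proof.
by rewrite -comp_lfunA -rigidity_intertwine comp_lfunA adjoint_U_comp comp_lfun1l.
Qed.

(** The injective map [U] carries the kernel of the rigidity map onto that of [multPhi]; a preimage
    of [F] is its image under the adjoint. *)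
Lemma dim_ker_rigidity :
  \dim (lker (rigidity_per C r)) = \dim (lker (multPhi C r)).
Proof.
have [aUa Uaa] := unitary_U R r (Ja C).
have -> : lker (multPhi C r) = (U R r (Ja C) @: lker (rigidity_per C r))%VS.
  apply/vspaceP => F; apply/idP/memv_imgP => [|[u + ->]]; rewrite !memv_ker => /eqP.
    move=> MF; exists (adjoint (U R r (Ja C)) F); last first.
      by rewrite -comp_lfunE Uaa id_lfunE.
    rewrite memv_ker rigidity_factor !comp_lfunE -[U _ _ _ (_ F)]comp_lfunE.
    by rewrite Uaa id_lfunE MF linear0.
  by rewrite -comp_lfunE -rigidity_intertwine comp_lfunE => ->; rewrite linear0.
rewrite limg_dim_eq //; apply/eqP; rewrite -subv0; apply/subvP => u.
rewrite memv_cap [X in _ && X]memv_ker => /andP[_ /eqP Uu].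
by rewrite -[u]id_lfunE -aUa comp_lfunE Uu linear0 mem0v.
Qed.
End Intertwining.

(** * Dimension of a space of functions constrained pointwise *)

Section Fibres.
Variables (K : fieldType) (I : finType) (n : nat).

Definition ffun_delta (i : I) (v : 'cV[K]_n) : {ffun I -> 'cV[K]_n} :=
  [ffun i' => if i' == i then v else 0].

Fact ffun_delta_linear i : linear (ffun_delta i).
Proof.
move=> a u v; apply/ffunP => j; rewrite !ffunE.
by case: eqP; rewrite ?scaler0 ?addr0.
Qed.
HB.instance Definition _ i := GRing.isLinear.Build K _ _ _ (ffun_delta i)
  (ffun_delta_linear i).

(** [W] is the internal direct sum of copies of the [V i], each embedded as the functions supported
    at [i] with value in [V i]. *)
Lemma dim_ffun_family (V : I -> {vspace 'cV[K]_n})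
    (W : {vspace {ffun I -> 'cV[K]_n}}) :
  (forall F, (F \in W) = [forall i, F i \in V i]) ->
  \dim W = (\sum_i \dim (V i))%N.
Proof.
move=> WE; pose D i := linfun (ffun_delta i).
have DE i v j : D i v j = if j == i then v else 0 by rewrite lfunE ffunE.
have sumE (v : I -> 'cV[K]_n) j : (\sum_i D i (v i)) j = v j.
  rewrite sum_ffunE (bigD1 j) //= DE eqxx big1 ?addr0 // => i ni.
  by rewrite DE eq_sym (negPf ni).
have dV i : \dim (D i @: V i) = \dim (V i).
  apply: limg_dim_eq; apply/eqP; rewrite -subv0; apply/subvP => v.
  rewrite memv_cap memv_ker memv0 => /andP[_ /eqP/ffunP/(_ i)].
  by rewrite DE eqxx ffunE => ->.
have -> : W = (\sum_i D i @: V i)%VS.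
  apply/vspaceP => F; rewrite WE; apply/forallP/memv_sumP => [FV|[Fs FsV ->] i].
    exists (fun i => D i (F i)) => [i _|]; first exact: memv_img.
    by apply/ffunP => j; rewrite sumE.
  rewrite sum_ffunE memv_suml // => j _.
  have /memv_imgP[v vV ->] := FsV j isT; rewrite DE.
  by case: eqP => [->|_]; rewrite ?mem0v.
(* Additivity of dimension is directness of the sum, and evaluating a vanishing sum at [i] isolates
   its [i]-th term. *)
rewrite -(eq_bigr _ (fun i _ => dV i)); apply/directvP.
apply/directv_sum_independent => Fs FsV Fs0 i _.
have /memv_imgP[v vV Fi] := FsV i isT.
move/ffunP/(_ i): Fs0; rewrite sum_ffunE (bigD1 i) //= big1 => [|j ji].
  by rewrite addr0 Fi DE eqxx ffunE => ->; rewrite linear0.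
have /memv_imgP[v' _ ->] := FsV j isT.
by rewrite DE eq_sym (negPf ji).
Qed.
End Fibres.

Theorem theorem3p3 (R : realType) (C : crystal R) (r : period) :
  [/\ unitary (U R r (Ja C)),
      unitary (U R r (Jb C)),
      rigidity_per C r =
        (adjoint (U R r (Jb C)) \o multPhi C r \o U R r (Ja C))%VF,
      \dim (lker (rigidity_per C r)) = \dim (lker (multPhi C r))
    & \dim (lker (multPhi C r)) =
        (\sum_(k : box r) \dim (lker (mulmx_hom (Phi C (omega_pow R k)))))%N].
Proof.
split; [exact: unitary_U | exact: unitary_U | exact: rigidity_factor
  | exact: dim_ker_rigidity |].
(* The count is first over points of the torus and is then reindexed by the box; the remaining goal
   is that the kernel of [multPhi] is determined pointwise. *)
rewrite (dim_ffun_family (V := fun w => lker (mulmx_hom (Phi C (val w))))).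
  by rewrite (reindex (@torus_pt R r)) //; exact: onW_bij (torus_pt_bij R r).
move=> F; rewrite memv_ker lfunE /=; apply/eqP/forallP => [/ffunP F0 w|F0].
  by rewrite memv_ker lfunE /=; have := F0 w; rewrite !ffunE => ->.
apply/ffunP => w; rewrite !ffunE; have := F0 w.
by rewrite memv_ker lfunE /= => /eqP.
Qed.
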